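(* Let $F$ be a field of characteristic zero, $A\subseteq M_n(F)$ a semisimple subalgebra containing the identity, and $\mathcal G$ the group of units of the centralizer of $A$ in $M_n(F)$. Let $X_1,\dots,X_k$ be generic $n\times n$ matrices over $F[x_{ij}^{(\alpha)}]$, and let $\bar R(A,n,k)$ be the subalgebra of $M_n(F[x_{ij}^{(\alpha)}])$ generated by $A$, $X_1,\dots,X_k$ and the scalar matrices $tr(u)\cdot1$ for $u$ in the ring generated by $A$ and the $X_\alpha$. Then $M_n(F[x_{ij}^{(\alpha)}])^{\mathcal G}=\bar R(A,n,k)$.
   Context: $\mathcal G$ acts on $M_n(F[x_{ij}^{(\alpha)}])\cong F[x_{ij}^{(\alpha)}]\otimes M_n(F)$ by letting $g(x_{ij}^{(\alpha)})$ be the $(i,j)$ entry of $gX_\alpha g^{-1}$ on the first factor and $a\mapsto g^{-1}ag$ on the second factor. *)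

(* Defs.v *)
From HB Require Import structures.
From mathcomp Require Import all_boot all_order all_algebra.
Set Implicit Arguments. Unset Strict Implicit. Unset Printing Implicit Defensive.
Import Order.TTheory GRing.Theory Num.Theory.
Local Open Scope ring_scope.

Fixpoint mpoly (R : comNzRingType) (N : nat) : comNzRingType :=
  match N with
  | 0 => R
  | N'.+1 => ({poly (mpoly R N')} : comNzRingType)
  end.

(* the variable y_m (0 if m >= N) *)
Fixpoint mvar (R : comNzRingType) (N : nat) (m : nat) : mpoly R N :=
  match N return mpoly R N with
  | 0 => 0
  | N'.+1 => if m == N' then 'X else (mvar R N' m)%:P
  end.

Fixpoint mconst (R : comNzRingType) (N : nat) (c : R) : mpoly R N :=
  match N return mpoly R N with
  | 0 => c
  | N'.+1 => (mconst N' c)%:P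
  end.

Fixpoint meval (R S : comNzRingType) (f : R -> S) (v : nat -> S) (N : nat)
  : mpoly R N -> S :=
  match N return mpoly R N -> S with
  | 0 => f
  | N'.+1 => fun p => (map_poly (@meval R S f v N') p).[v N']
  end.

Definition mxnat (R : nzRingType) (n : nat) (M : 'M[R]_n) (i j : nat) : R :=
  match insub i, insub j with
  | Some i', Some j' => M i' j'
  | _, _ => 0
  end.

(* Number of variables x_ij^(alpha), alpha < k, i,j < n, and their indexing:
   x_ij^(alpha) is the variable number alpha*(n*n) + i*n + j. *)
Definition nvars (n k : nat) : nat := (k * (n * n))%N.
Definition xidx (n alpha i j : nat) : nat := (alpha * (n * n) + i * n + j)%N.

Definition PR (F : fieldType) (n k : nat) : comNzRingType := mpoly F (nvars n k).

Definition genmx (F : fieldType) (n k alpha : nat) : 'M[PR F n k]_n :=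
  \matrix_(i < n, j < n) mvar F (nvars n k) (xidx n alpha i j).

Definition cmx (F : fieldType) (n k : nat) (a : 'M[F]_n) : 'M[PR F n k]_n :=
  map_mx (@mconst F (nvars n k)) a.

(* action of g on F[x]: x_ij^(alpha) |-> (g X_alpha g^-1)_ij *)
Definition gsubst (F : fieldType) (n k : nat) (g : 'M[F]_n) (p : PR F n k)
  : PR F n k :=
  meval (@mconst F (nvars n k))
    (fun m => mxnat (@cmx F n k g *m @genmx F n k (m %/ (n * n)) *m @cmx F n k (invmx g))
                    ((m %% (n * n)) %/ n) (m %% n))
    p.

(* action of g on M_n(F[x]) = F[x] (x) M_n(F): substitution on the first
   factor, a |-> g^-1 a g on the second *)
Definition gact (F : fieldType) (n k : nat) (g : 'M[F]_n) (M : 'M[PR F n k]_n)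
  : 'M[PR F n k]_n :=
  @cmx F n k (invmx g) *m map_mx (gsubst g) M *m @cmx F n k g.

Definition unital_subalg (F : fieldType) (n : nat) (A : 'M[F]_n -> Prop) : Prop :=
  [/\ A 0, A 1%:M,
      (forall a b, A a -> A b -> A (a + b)),
      (forall c a, A a -> A (c *: a)) &
      (forall a b, A a -> A b -> A (a *m b))].

Definition is_ideal (F : fieldType) (n : nat) (A I : 'M[F]_n -> Prop) : Prop :=
  [/\ (forall a, I a -> A a), I 0,
      (forall a b, I a -> I b -> I (a + b)) /\
      (forall c a, I a -> I (c *: a)),
      (forall a b, A a -> I b -> I (a *m b)) &
      (forall a b, I a -> A b -> I (a *m b))].

Definition nilpotent_mx (F : fieldType) (n : nat) (a : 'M[F]_n) : Prop :=
  exists m : nat, iter m (mulmx a) 1%:M = 0.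

(* semisimple (finite-dimensional) algebra: Jacobson radical is zero, i.e.
   A has no nonzero nilpotent (nil) two-sided ideal *)
Definition semisimple_alg (F : fieldType) (n : nat) (A : 'M[F]_n -> Prop) : Prop :=
  forall I, is_ideal A I -> (forall a, I a -> nilpotent_mx a) ->
  forall a, I a -> a = 0.

Inductive alg_gen (F : fieldType) (n k : nat) (S : 'M[PR F n k]_n -> Prop)
  : 'M[PR F n k]_n -> Prop :=
  | ag_base M : S M -> alg_gen S M
  | ag_one : alg_gen S 1%:M
  | ag_add M N : alg_gen S M -> alg_gen S N -> alg_gen S (M + N)
  | ag_scale (c : F) M : alg_gen S M -> alg_gen S (mconst (nvars n k) c *: M)
  | ag_mul M N : alg_gen S M -> alg_gen S N -> alg_gen S (M *m N).

Definition AX (F : fieldType) (n k : nat) (A : 'M[F]_n -> Prop)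
  (M : 'M[PR F n k]_n) : Prop :=
  (exists a, A a /\ M = @cmx F n k a) \/ (exists alpha, (alpha < k)%N /\ M = @genmx F n k alpha).

Definition Rbar (F : fieldType) (n k : nat) (A : 'M[F]_n -> Prop)
  : 'M[PR F n k]_n -> Prop :=
  alg_gen (fun M => AX A M \/ exists u, alg_gen (AX A) u /\ M = (\tr u)%:M).

(* Main.v *)
Require Import Defs.
From HB Require Import structures.
From mathcomp Require Import all_boot all_order all_algebra fingroup perm.
From Stdlib Require Import Classical.
Set Implicit Arguments. Unset Strict Implicit. Unset Printing Implicit Defensive.
Import GRing.Theory.
Local Open Scope ring_scope.

(** Write [C] for the centralizer of [A] and [V = F^n].  Polarizing the degree
    [d] component of an invariant [M] gives endomorphisms of the tensor power
    of [V] with exponent [d + 1] which commute with [g (x) ... (x) g] for all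
    units [g] of [C]; one slot carries the output of [M].  The trace form of the
    regular representation of [A] is nondegenerate, since its radical is a nil
    ideal, so it yields [b_i, b'_i] in [A] with [sum_i b_i b'_i = 1] and
    [sum_i b_i S b'_i] in [C] for every [S].  Combined with averaging over the
    symmetric group, this is a separability idempotent for the algebra [B]
    spanned by the [s (a_0 (x) ... (x) a_d)] with [s] a permutation of the slots
    and [a_t] in [A], and the double centralizer argument places the above
    endomorphisms in [B].  Contracting an element of [B] with generic matrices
    produces products of traces of words, one for each cycle of [s], times the
    word read along the cycle through the output slot. *)

(** * Semisimple algebras and their trace form *)

Section TraceNilpotent.
Variable F : fieldType.
Hypothesis pcharF0 : [pchar F] =i pred0.

Lemma natr_eq0 d : (d%:R == 0 :> F) = (d == 0)%N.
Proof. by have/pcharf0P-> := pcharF0. Qed.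

(** The integers below [size p] are distinct in characteristic zero, and they are more roots than a
    nonzero [p] can have. *)
Lemma poly_eq0_fun (p : {poly F}) : (forall c, p.[c] = 0) -> p = 0.
Proof.
move=> p0; apply/eqP; apply: contraT => nzp.
pose s := [seq i%:R : F | i <- iota 0 (size p)].
suff /(max_poly_roots nzp) : all (root p) s.
  rewrite /s size_map size_iota ltnn => -> //.
  rewrite map_inj_uniq ?iota_uniq // => i j.
  wlog le_ij: i j / (i <= j)%N.
    by move=> W; case: (leqP i j) => [/W //|/ltnW/W H /esym/H].
  move=> /eqP; rewrite eq_sym -subr_eq0 -natrB //.
  by rewrite natr_eq0 subn_eq0 => le_ji; apply/eqP; rewrite eqn_leq le_ij.
by apply/allP=> x _; rewrite /root p0.
Qed.

(** In a full rank factorization [E = C R], idempotence forces [R C] to be the identity of size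
    [\rank E]. *)
Lemma mxtrace_idem r (E : 'M[F]_r) : E *m E = E -> \tr E = (\rank E)%:R.
Proof.
move=> EE; have := mulmx_base E; set C := col_base E; set R := row_base E => CR.
have RC1 : R *m C = 1%:M.
  apply: (row_full_inj (col_base_full E)).
  apply: (row_free_inj (row_base_free E)) => /=.
  by rewrite mulmx1 mulmxA CR -mulmxA CR EE.
by rewrite -{1}CR mxtrace_mulC RC1 mxtrace1.
Qed.

(* A polynomial without constant term in [L] gives the Fitting idempotent of
   [L]; its trace is its rank. *)
Lemma mxtrace_exp_nilp r (L : 'M[F]_r) :
  (forall j, \tr (L ^+ j.+1) = 0) -> exists N, L ^+ N = 0.
Proof.
case: r => [|r] in L *; first by exists 0%N; apply/matrixP=> -[].
move=> trL.
have trp j (p : {poly F}) : \tr (horner_mx L (p * 'X^(j.+1))) = 0.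
  elim/poly_ind: p j => [|p c IH] j; first by rewrite mul0r rmorph0 mxtrace0.
  rewrite mulrDl -mulrA -exprS rmorphD mxtraceD IH add0r.
  rewrite rmorphM rmorphXn /= horner_mx_X horner_mx_C -mulmxE mul_scalar_mx.
  by rewrite mxtraceZ trL mulr0.
have [m [q]] := multiplicity_XsubC (char_poly L) 0.
rewrite -size_poly_gt0 size_char_poly /= subr0 => q0 def_chi.
have : coprimep 'X^(m.+1) q by rewrite coprimep_expl // coprimep_sym coprimepX.
case/Bezout_eq1_coprimepP => -[u v] /= uv1.
(* Using [m.+1] instead of the multiplicity [m] leaves [E] without constant term even when [m = 0],
   so that [trp] applies. *)
pose E := horner_mx L (u * 'X^(m.+1)).
have LmE (p : {poly F}) : horner_mx L (p * 'X^(m.+1) * q) = 0.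
  have -> : p * 'X^(m.+1) * q = p * 'X * char_poly L.
    by rewrite def_chi exprS [q * _]mulrC !mulrA.
  by rewrite rmorphM /= Cayley_Hamilton mulr0.
(* By Bezout [1 - E] is the value of [v * q] at [L], and Cayley-Hamilton kills every multiple of
   ['X^(m.+1) * q]. *)
have E1 (p : {poly F}) : horner_mx L (p * 'X^(m.+1)) *m E = horner_mx L (p * 'X^(m.+1)).
  apply/eqP; rewrite -subr_eq0 -[X in _ - X]mulmx1 -mulmxBr.
  rewrite -[1%:M](rmorph1 (horner_mx L)) -[X in _ *m (_ - horner_mx _ X)]uv1.
  rewrite rmorphD opprD addNKr mulmxN oppr_eq0 mulmxE -rmorphM /=.
  by rewrite (mulrA _ v q) [_ * v]mulrC (mulrA v) LmE.
exists m.+1; have := E1 1; rewrite mul1r rmorphXn /= horner_mx_X => <-.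
have := trp m u; rewrite -/E mxtrace_idem ?E1 // => /eqP.
by rewrite natr_eq0 mxrank_eq0 => /eqP->; rewrite mulmx0.
Qed.
End TraceNilpotent.

(** * Separability idempotents of semisimple algebras *)

Section SeparabilityIdempotent.
Variables (F : fieldType) (n : nat).

(** [A] need not be decidable: classical logic enlarges a subspace inside [A] by one vector at a
    time, and [d] bounds the remaining codimension. *)
Lemma vspace_of_pred (A : 'M[F]_n -> Prop) :
  A 0 -> (forall a b, A a -> A b -> A (a + b)) ->
  (forall c a, A a -> A (c *: a)) ->
  exists V : {vspace 'M[F]_n}, forall a, A a <-> a \in V.
Proof.
move=> A0 AD AZ.
suff W d : forall V : {vspace 'M[F]_n}, (forall a, a \in V -> A a) ->
    (\dim {:'M[F]_n} - \dim V <= d)%N ->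
    exists V : {vspace 'M[F]_n}, forall a, A a <-> a \in V.
  by apply: (W _ 0%VS) => // a; rewrite memv0 => /eqP->.
elim: d => [|d IH] V VA dimV; have [AV|] := classic (forall a, A a -> a \in V).
- by exists V => a; split=> [/AV|/VA].
- case=> a _; rewrite (_ : V = fullv) ?memvf //.
  by apply/eqP; rewrite eqEdim subvf -subn_eq0 -leqn0.
- by exists V => a; split=> [/AV|/VA].
- move=> nAV; have [a nAa] := not_all_ex_not _ _ nAV.
  have [Aa /negP aV] := imply_to_and _ _ nAa.
  apply: (IH (V + <[a]>)%VS).
    by move=> _ /memv_addP[u /VA Au [_ /vlineP[c ->] ->]]; apply/AD/AZ.
  have lt_dim : (\dim V < \dim (V + <[a]>))%N.
    rewrite ltnNge; apply: contra aV => le_dim.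
    have /eqP-> : V == (V + <[a]>)%VS by rewrite eqEdim addvSl.
    exact: (subvP (addvSr _ _)) (memv_line a).
  move: dimV; rewrite !leq_subLR addnS => /leq_trans; apply.
  by rewrite ltn_add2r.
Qed.

Hypothesis pcharF0 : [pchar F] =i pred0.

(** The [b i] form a basis of [A] and the [b' i] the dual basis for the trace form of the regular
    representation. *)
Lemma separability_idempotent (A : 'M[F]_n -> Prop) :
  unital_subalg A -> semisimple_alg A ->
  exists r (b b' : 'I_r -> 'M[F]_n),
    [/\ forall i, A (b i), forall i, A (b' i), \sum_i b i *m b' i = 1%:M &
        forall S a, A a ->
          a *m (\sum_i b i *m S *m b' i) = (\sum_i b i *m S *m b' i) *m a].
Proof.
case=> A0 A1 AD AZ AM' ssA.
have [V AV] := vspace_of_pred A0 AD AZ.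
have AM a b : a \in V -> b \in V -> a *m b \in V.
  by move=> /AV Aa /AV Ab; apply/AV/AM'.
move/AV: A1 => A1.
pose e (i : 'I_(\dim V)) := (vbasis V)`_i.
pose k i : {scalar (matrix F n n)} := coord (vbasis V) i.
have Ae i : e i \in V by apply/vbasis_mem/mem_nth; rewrite size_tuple.
have ek a : a \in V -> a = \sum_i k i a *: e i by move/coord_vbasis.
have ke i j : k i (e j) = (j == i)%:R.
  exact: (coord_free j i (basis_free (vbasisP V))).
(* Left multiplication in the basis [e], with images as rows; hence [L] reverses products. *)
pose L a : 'M[F]_(\dim V) := \matrix_(i, j) k j (a *m e i).
have LM a b : a \in V -> b \in V -> L (a *m b) = L b *m L a.
  move=> Aa Ab; apply/matrixP=> i j; rewrite !mxE -mulmxA.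
  rewrite {1}[b *m e i]ek; last exact: AM.
  rewrite mulmx_sumr linear_sum; apply: eq_bigr => l _.
  by rewrite -scalemxAr linearZ !mxE.
pose tau a := \tr (L a).
have tau_is_linear : scalar tau.
  move=> c a b; rewrite /tau -mxtraceZ -mxtraceD; congr (\tr _).
  by apply/matrixP=> i j; rewrite !mxE mulmxDl linearD -scalemxAl linearZ.
pose tl : {scalar 'M[F]_n} :=
  HB.pack tau (GRing.isLinear.Build F 'M[F]_n F *%R tau tau_is_linear).
have tau0 : tau 0 = 0 := linear0 tl.
have tauD a b : tau (a + b) = tau a + tau b := linearD tl a b.
have tauB a b : tau (a - b) = tau a - tau b := linearB tl a b.
have tauZ c a : tau (c *: a) = c * tau a by exact: (linearZ_LR tl).
have tauS m (f : 'I_m -> 'M[F]_n) : tau (\sum_i f i) = \sum_i tau (f i).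
  exact: (linear_sum tl).
have tauC a b : a \in V -> b \in V -> tau (a *m b) = tau (b *m a).
  by move=> Aa Ab; rewrite /tau !LM // mxtrace_mulC.
have nondeg a : a \in V -> (forall b, b \in V -> tau (a *m b) = 0) -> a = 0.
  (* The radical of the trace form is an ideal by [tauC]. On it the traces of all positive powers of
     [L a] vanish, so it consists of nilpotents. *)
  move=> Aa a0; pose I a := a \in V /\ forall b, b \in V -> tau (a *m b) = 0.
  apply: (ssA I) => [||//].
    split; first by move=> x [/AV].
    - by split=> [|b _]; rewrite ?mem0v // mul0mx tau0.
    - split=> [x y [Ax x0] [Ay y0]|c x [Ax x0]].
        by split=> [|b Ab]; [exact: rpredD|rewrite mulmxDl tauD x0 ?y0 ?addr0].
      by split=> [|b Ab]; [exact: rpredZ|rewrite -scalemxAl tauZ x0 ?mulr0].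
    - move=> x y /AV Ax [Ay y0]; split=> [|b Ab]; first exact: AM.
      by rewrite -mulmxA tauC ?AM // -mulmxA y0 // AM.
    - move=> x y [Ax x0] /AV Ay; split=> [|b Ab]; first exact: AM.
      by rewrite -mulmxA x0 // AM.
  move=> {Aa a0} {}a [Aa a0].
  have AX j : iter j (mulmx a) 1%:M \in V by elim: j => //= j IH; exact: AM.
  have LX j : L (iter j (mulmx a) 1%:M) = (L a) ^+ j.
    elim: j => [|j IH]; last by rewrite iterS LM // IH exprSr.
    by apply/matrixP=> i j; rewrite !mxE mul1mx ke.
  have [|N LN0] := @mxtrace_exp_nilp _ pcharF0 _ (L a).
    by move=> j; rewrite -LX iterS; apply: a0.
  (* Nilpotence descends from [L a] to [a]: row [i] of [L a ^+ N] holds the coordinates of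
     [a^N e_i], and [1] is a combination of the [e i]. *)
  exists N; rewrite -[LHS]mulmx1 [X in _ *m X]ek // mulmx_sumr big1 // => i _.
  rewrite -scalemxAr [_ *m _]ek ?AM // big1 ?scaler0 // => j _.
  by have /matrixP/(_ i j) := LN0; rewrite -LX !mxE => ->; rewrite scale0r.
pose G : 'M[F]_(\dim V) := \matrix_(i, j) tau (e i *m e j).
have Gu : G \in unitmx.
  rewrite -row_free_unit; apply/row_freeP; apply/row_freeP.
  rewrite -kermx_eq0; apply/eqP/row_matrixP=> i; rewrite row0.
  set v := row i _.
  have vG : v *m G = 0 by rewrite /v -row_mul mulmx_ker row0.
  pose a := \sum_i v 0 i *: e i.
  have Aa : a \in V by apply: rpred_sum => l _; apply: rpredZ.
  have a0 : a = 0.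
    apply: nondeg => // b Ab; rewrite [b]ek // mulmx_sumr tauS big1 // => j _.
    rewrite -scalemxAr tauZ mulmx_suml tauS.
    have /matrixP/(_ 0 j) := vG; rewrite !mxE => vGj.
    rewrite (eq_bigr (fun i => v 0 i * G i j)) ?vGj ?mulr0 // => l _.
    by rewrite -scalemxAl tauZ [G _ _]mxE.
  apply/rowP=> j; rewrite [RHS]mxE; have := congr1 (k j) a0.
  rewrite linear0 linear_sum (bigD1 j) //= linearZ /= ke eqxx mulr1.
  by rewrite big1 ?addr0 // => l lj; rewrite linearZ /= ke (negPf lj) mulr0.
(* The inverse Gram matrix yields the dual basis. *)
pose e' j := \sum_i (invmx G) i j *: e i.
have Ae' j : e' j \in V by apply: rpred_sum => l _; apply: rpredZ.
have ee' i j : tau (e i *m e' j) = (i == j)%:R.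
  have /matrixP/(_ i j) := mulmxV Gu; rewrite !mxE => <-.
  rewrite mulmx_sumr tauS; apply: eq_bigr => l _.
  by rewrite -scalemxAr tauZ !mxE mulrC.
have exp1 a i : a \in V -> k i a = tau (a *m e' i).
  move=> Aa; rewrite [in RHS](ek a) // mulmx_suml tauS (bigD1 i) //= -scalemxAl.
  rewrite tauZ ee' eqxx [LHS](esym (mulr1 _)) big1 ?addr0 // => j ji.
  by rewrite -scalemxAl tauZ ee' (negPf ji) mulr0.
have exp2 a : a \in V -> a = \sum_i tau (a *m e i) *: e' i.
  move=> Aa; apply/eqP; rewrite -subr_eq0; apply/eqP/nondeg.
    by apply: rpredB => //; apply: rpred_sum => i _; apply: rpredZ.
  move=> b Ab; rewrite [b]ek // mulmx_sumr tauS big1 // => j _.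
  rewrite -scalemxAr tauZ mulmxBl tauB mulmx_suml.
  rewrite tauS (bigD1 j) //= -scalemxAl tauZ (tauC (e' j)) // ee' eqxx.
  rewrite big1 ?addr0 => [|l lj].
    by rewrite mulr1 subrr mulr0.
  by rewrite -scalemxAl tauZ (tauC (e' l)) // ee' eq_sym (negPf lj) mulr0.
exists (\dim V), e, e'; split.
- by move=> i; apply/AV.
- by move=> i; apply/AV.
(* Paired with [b], the sum gives the sum of the [i]-th coordinates of [b *m e i], which is the
   trace of [L b], that is [tau b]. *)
- apply/eqP; rewrite -subr_eq0; apply/eqP/nondeg.
    by apply: rpredB => //; apply: rpred_sum => i _; apply: AM.
  move=> b Ab; rewrite mulmxBl mul1mx tauB mulmx_suml tauS.
  apply/eqP; rewrite subr_eq0; apply/eqP; rewrite [RHS](_ : _ = \sum_i L b i i) //.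
  apply: eq_bigr => i _.
  by rewrite mxE exp1 ?AM // (tauC _ b) ?AM // mulmxA.
move=> S a /AV Aa; rewrite mulmx_sumr mulmx_suml.
(* Expanding [a *m e i] in [e], and [e' j *m a] in [e'], produces the same coefficients
   [tau (e' j *m a *m e i)]. *)
have lhs i : a *m (e i *m S *m e' i) =
    \sum_j tau (e' j *m a *m e i) *: (e j *m S *m e' i).
  rewrite !mulmxA [X in X *m S]ek ?AM // !mulmx_suml; apply: eq_bigr => j _.
  by rewrite -!scalemxAl exp1 ?AM // (tauC _ (e' j)) ?AM // mulmxA.
have rhs j : e j *m S *m e' j *m a =
    \sum_i tau (e' j *m a *m e i) *: (e j *m S *m e' i).
  rewrite -!mulmxA {1}[e' j *m a]exp2 ?AM // !mulmx_sumr.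
  by apply: eq_bigr => i _; rewrite -!scalemxAr !mulmxA.
by rewrite (eq_bigr _ (fun i _ => lhs i)) exchange_big (eq_bigr _ (fun i _ => rhs i)).
Qed.
End SeparabilityIdempotent.

(** * Tensor powers of matrices *)

Section Polarization.
Variable R : comNzRingType.

(* The sign [(-1)^(m - #|S|)] of Ryser's inclusion-exclusion formula. *)
Definition psign m (S : {set 'I_m}) : R := \prod_i (if i \in S then 1 else - 1).

(** The sum over [S] factors over the points [i]; a point missed by [f] contributes [1 - 1], so only
    surjective, hence injective, [f] survive. *)
Lemma sum_psign_imset m (f : 'I_m -> 'I_m) :
  \sum_(S : {set 'I_m}) psign S * \prod_t (f t \in S)%:R = (injectiveb f)%:R.
Proof.
pose u i : R := if i \in codom f then 0 else - 1.
transitivity (\sum_(S : {set 'I_m}) \prod_i (if i \in S then 1 else u i)).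
  apply: eq_bigr => S _; have [fS|] := boolP [forall t, f t \in S].
    rewrite [X in _ * X]big1 ?mulr1 => [|t _]; last by rewrite (forallP fS).
    apply: eq_bigr => i _; case: ifPn => // iS; rewrite /u ifN //.
    by apply: contra iS => /codomP[t ->]; apply: (forallP fS).
  rewrite negb_forall => /existsP[t ftS].
  rewrite (bigD1 t) //= (negPf ftS) mul0r mulr0.
  by rewrite (bigD1 (f t)) //= (negPf ftS) /u codom_f mul0r.
have -> : \sum_(S : {set 'I_m}) \prod_i (if i \in S then 1 else u i) = \prod_i (1 + u i).
  by rewrite bigA_distr; apply: eq_bigl => S; rewrite inE.
have [inj|] := boolP (injectiveb f).
  rewrite big1 // => i _; rewrite /u ifT ?addr0 //.
  exact: injF_onto (injectiveP _ inj) i.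
move=> ninj; have /existsP[i fi] : [exists i, i \notin codom f].
  rewrite -negb_forall; apply: contra ninj => /forallP onto.
  apply/injectiveP=> t1 t2 ft; suff /image_injP inj : #|image f 'I_m| == #|'I_m|.
    exact: inj ft.
  by rewrite (eq_card (B := 'I_m)) // => i; rewrite inE; apply: onto.
by rewrite (bigD1 i) //= /u (negPf fi) addrN mul0r.
Qed.

(** Ryser's formula for the permanent: the right side expands over all maps [f], and the signed sum
    over [S] keeps the permutations. *)
Lemma sum_perm_polarize m (x : 'I_m -> 'I_m -> R) :
  \sum_(s : 'S_m) \prod_t x t (s t) =
  \sum_(S : {set 'I_m}) psign S * \prod_t \sum_(i in S) x t i.
Proof.
have expand S : psign S * \prod_t \sum_(i in S) x t i =
    \sum_(f : {ffun 'I_m -> 'I_m})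
      psign S * \prod_t (f t \in S)%:R * \prod_t x t (f t).
  rewrite (eq_bigr (fun t => \sum_i (i \in S)%:R * x t i)) => [|t _].
    rewrite bigA_distr_bigA mulr_sumr.
    by apply: eq_bigr => f _; rewrite big_split mulrA.
  rewrite big_mkcond; apply: eq_bigr => i _.
  by case: ifP; rewrite ?mul1r ?mul0r.
rewrite (eq_bigr _ (fun S _ => expand S)).
rewrite exchange_big /=.
transitivity (\sum_(f : {ffun 'I_m -> 'I_m} | injectiveb f) \prod_t x t (f t)).
  rewrite (reindex (@pval _)) /=; last first.
    pose in_Sn := insubd (1%g : 'S_m).
    by exists in_Sn => f Uf; first apply: val_inj; apply: insubdK.
  by apply: eq_big => [s|s _]; [rewrite (valP s)|apply: eq_bigr => i _; rewrite pvalE].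
rewrite big_mkcond; apply: eq_bigr => f _.
by rewrite -mulr_suml sum_psign_imset; case: injectiveb; rewrite ?mul1r ?mul0r.
Qed.
End Polarization.

(** * Tensor products and permutations of the slots *)

Section Tensor.
Variables (R : comNzRingType) (n m : nat).
Notation I := {ffun 'I_m -> 'I_n}.
Implicit Types (Z Y : 'I_m -> 'M[R]_n) (s : 'S_m).

(** The Kronecker product of the [Z t]; rows and columns are multi-indices, numbered by
    [enum_val]. *)
Definition tens Z : 'M[R]_#|{: I}| :=
  \matrix_(i < #|{: I}|, j < #|{: I}|) \prod_t Z t (enum_val i t) (enum_val j t).

Definition slotperm_mx s : 'M[R]_#|{: I}| :=
  \matrix_(i < #|{: I}|, j < #|{: I}|) ([ffun t => enum_val i (s t)] == enum_val j)%:R.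

Lemma sum_enum_val (f : I -> R) : \sum_(i < #|{: I}|) f (enum_val i) = \sum_i f i.
Proof. by rewrite -(big_enum_val (A := predT) f). Qed.

Lemma eq_tens Z Y : Z =1 Y -> tens Z = tens Y.
Proof.
by move=> ZY; apply/matrixP=> i j; rewrite !mxE; apply: eq_bigr => t _; rewrite ZY.
Qed.

Lemma tensM Z Y : tens Z *m tens Y = tens (fun t => Z t *m Y t).
Proof.
apply/matrixP=> i j; rewrite mxE [RHS]mxE.
pose G (k : I) := \prod_t (Z t (enum_val i t) (k t) * Y t (k t) (enum_val j t)).
rewrite (eq_bigr (fun k => G (enum_val k))) => [|k _]; last by rewrite !mxE -big_split.
rewrite sum_enum_val; under [RHS]eq_bigr => t _ do rewrite mxE.
by rewrite bigA_distr_bigA.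
Qed.

Lemma tens1 : tens (fun=> 1%:M) = 1%:M.
Proof.
apply/matrixP=> i j; rewrite !mxE -(inj_eq enum_val_inj).
have [/eqP->|nij] := boolP (enum_val i == enum_val j).
  by rewrite big1 // => t _; rewrite mxE eqxx.
suff /existsP[t /negPf tij] : [exists t, enum_val i t != enum_val j t].
  by rewrite (bigD1 t) //= mxE tij mul0r.
rewrite -negb_forall; apply: contra nij => /forallP e.
by apply/eqP/ffunP=> t; apply/eqP.
Qed.

(** Matrix units of the tensor power are pure tensors, so linear identities in an endomorphism need
    only be checked on pure tensors. *)
Lemma tens_delta (f g : I) :
  tens (fun t => delta_mx (f t) (g t)) = delta_mx (enum_rank f) (enum_rank g).
Proof.
apply/matrixP=> i j; rewrite !mxE -!(inj_eq enum_val_inj) !enum_rankK.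
under eq_bigr => t _ do rewrite mxE.
have [/andP[/eqP-> /eqP->]|nij] := boolP (_ && _).
  by rewrite big1 // => t _; rewrite !eqxx.
suff /existsP[t /negPf tij] :
    [exists t, ~~ ((enum_val i t == f t) && (enum_val j t == g t))].
  by rewrite (bigD1 t) //= tij mul0r.
rewrite -negb_forall; apply: contra nij => /forallP e.
by apply/andP; split; apply/eqP/ffunP=> t; apply/eqP; case/andP: (e t).
Qed.

Lemma tens_sum (J : finType) (Z : 'I_m -> J -> 'M[R]_n) :
  tens (fun t => \sum_j Z t j) = \sum_(f : {ffun 'I_m -> J}) tens (fun t => Z t (f t)).
Proof.
apply/matrixP=> i j; rewrite mxE summxE.
under eq_bigr => t _ do rewrite summxE.
by rewrite bigA_distr_bigA; apply: eq_bigr => f _; rewrite mxE.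
Qed.

Lemma mul_slotperm_mx s (T : 'M[R]_#|{: I}|) i j :
  (slotperm_mx s *m T) i j = T (enum_rank [ffun t => enum_val i (s t)]) j.
Proof.
rewrite mxE (bigD1 (enum_rank [ffun t => enum_val i (s t)])) //= !mxE.
rewrite enum_rankK eqxx mul1r big1 ?addr0 // => k ki; rewrite mxE -(can_eq enum_rankK).
by rewrite enum_valK eq_sym (negPf ki) mul0r.
Qed.

Lemma slotpermM s1 s2 : slotperm_mx s1 *m slotperm_mx s2 = slotperm_mx (s2 * s1).
Proof.
apply/matrixP=> i j; rewrite mul_slotperm_mx !mxE enum_rankK; congr (_ == _)%:R.
by apply/ffunP=> t; rewrite !ffunE permM.
Qed.

Lemma slotperm1 : slotperm_mx 1 = 1%:M.
Proof.
apply/matrixP=> i j; rewrite !mxE -(inj_eq enum_val_inj); congr (_ == _)%:R.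
by apply/ffunP=> t; rewrite ffunE perm1.
Qed.

Lemma slotperm_tens s Z :
  slotperm_mx s *m tens Z = tens (fun t => Z (s^-1%g t)) *m slotperm_mx s.
Proof.
have VK : slotperm_mx s^-1 *m slotperm_mx s = 1%:M by rewrite slotpermM mulgV slotperm1.
suff E : slotperm_mx s *m tens Z *m slotperm_mx s^-1 = tens (fun t => Z (s^-1%g t)).
  by rewrite -E -[in RHS]mulmxA VK mulmx1.
apply/matrixP=> i j; rewrite -mulmxA mul_slotperm_mx mxE.
rewrite (bigD1 (enum_rank [ffun t => enum_val j (s t)])) //= big1 => [|k kj].
  rewrite addr0 !mxE !enum_rankK [_ == _](_ : _ = true) ?mulr1.
    rewrite [RHS](reindex_inj (@perm_inj _ s)); apply: eq_bigr => t _.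
    by rewrite permK !ffunE.
  by apply/eqP/ffunP=> t; rewrite !ffunE permKV.
rewrite [slotperm_mx _ _ _]mxE [_ == _](_ : _ = false) ?mulr0 //.
apply: contraNF kj => /eqP/ffunP e; rewrite -(inj_eq enum_val_inj) enum_rankK.
by apply/eqP/ffunP=> t; rewrite !ffunE -e ffunE permK.
Qed.

End Tensor.

Lemma map_tens (R S : comNzRingType) (f : {rmorphism R -> S}) n m (Z : 'I_m -> 'M[R]_n) :
  map_mx f (tens Z) = tens (fun t => map_mx f (Z t)).
Proof.
by apply/matrixP=> i j; rewrite !mxE rmorph_prod; apply: eq_bigr => t _; rewrite mxE.
Qed.

(** * The centralizer of the tensor powers of the centralizer *)

Section DoubleCentralizer.
Variable F : fieldType.

(* The commutation hypothesis says [sum_j T p_j (x) q_j = sum_j p_j (x) q_j T];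
   projecting the second factor onto [B] and multiplying gives
   [c T = sum_j p_j pi (q_j T)]. *)
Lemma double_centralizer N (J : finType) (p q : J -> 'M[F]_N) (B : {vspace 'M[F]_N})
    (T : 'M[F]_N) (c : F) :
  c != 0 -> \sum_j p j *m q j = c%:M ->
  (forall j, q j \in B) -> (forall j a, a \in B -> p j *m a \in B) ->
  (forall S, T *m (\sum_j p j *m S *m q j) = (\sum_j p j *m S *m q j) *m T) ->
  T \in B.
Proof.
move=> c0 pq qB pB comT.
(* Taking matrix units for [S] in [comT] separates the two tensor factors; this is the coefficient
   at [(a, b)] of the second one. *)
have entry a b : \sum_j q j a b *: (T *m p j) = \sum_j (q j *m T) a b *: p j.
  have deltaE (X Y : 'M[F]_N) x z : (X *m delta_mx z a *m Y) x b = X x z * Y a b.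
    rewrite mxE (bigD1 a) //= big1 ?addr0 => [|l la].
      rewrite mxE (bigD1 z) //= mxE !eqxx mulr1 big1 ?addr0 // => l lz.
      by rewrite mxE (negPf lz) mulr0.
    by rewrite mxE big1 ?mul0r // => k _; rewrite mxE (negPf la) andbF mulr0.
  apply/matrixP=> x z; have /matrixP/(_ x b) := comT (delta_mx z a).
  rewrite mulmx_sumr mulmx_suml !summxE => e.
  transitivity (\sum_j (T *m (p j *m delta_mx z a *m q j)) x b).
    by apply: eq_bigr => j _; rewrite !mulmxA deltaE mxE mulrC.
  by rewrite e; apply: eq_bigr => j _; rewrite -mulmxA deltaE [RHS]mxE mulrC.
pose P X := projv B X.
have PE X : P X = \sum_a \sum_b X a b *: P (delta_mx a b).
  rewrite {1}[X]matrix_sum_delta /P linear_sum; apply: eq_bigr => a _.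
  by rewrite linear_sum; apply: eq_bigr => b _; rewrite linearZ.
have sum_PE (X Y : J -> 'M[F]_N) : \sum_j X j *m P (Y j) =
    \sum_a \sum_b (\sum_j Y j a b *: X j) *m P (delta_mx a b).
  transitivity (\sum_j \sum_a \sum_b (Y j a b *: X j) *m P (delta_mx a b)).
    apply: eq_bigr => j _; rewrite [P (Y j)]PE mulmx_sumr; apply: eq_bigr => a _.
    by rewrite mulmx_sumr; apply: eq_bigr => b _; rewrite -scalemxAr -scalemxAl.
  rewrite exchange_big; apply: eq_bigr => a _.
  by rewrite exchange_big; apply: eq_bigr => b _; rewrite mulmx_suml.
(* The separated identity is linear in the second factor, so [P] may be applied there before
   multiplying the factors. *)
have TE : \sum_j (T *m p j) *m P (q j) = \sum_j p j *m P (q j *m T).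
  by rewrite !sum_PE; apply: eq_bigr => a _; apply: eq_bigr => b _; rewrite entry.
have -> : T = c^-1 *: \sum_j p j *m P (q j *m T).
  rewrite -TE; under eq_bigr => j _ do rewrite /P projv_id // -mulmxA.
  by rewrite -mulmx_sumr pq mul_mx_scalar scalerA mulVf // scale1r.
by apply/rpredZ/rpred_sum => j _; apply/pB/memv_proj.
Qed.

(** The linear span in impredicative form, which serves directly as an induction principle. *)
Definition lspan N (G : 'M[F]_N -> Prop) (T : 'M[F]_N) : Prop :=
  forall Q : 'M[F]_N -> Prop, Q 0 -> (forall a b, Q a -> Q b -> Q (a + b)) ->
    (forall c a, Q a -> Q (c *: a)) -> (forall a, G a -> Q a) -> Q T.

Variables (n m : nat) (A : 'M[F]_n -> Prop).
Hypotheses (pcharF0 : [pchar F] =i pred0) (sA : unital_subalg A) (ssA : semisimple_alg A).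

(* [c + x] is a unit for all but finitely many scalars [x]. *)
Lemma commute_tens_centralizer (T : 'M[F]_#|{: {ffun 'I_m -> 'I_n}}|) (c : 'M[F]_n) :
  (forall g, g \in unitmx -> (forall a, A a -> g *m a = a *m g) ->
     T *m tens (fun=> g) = tens (fun=> g) *m T) ->
  (forall a, A a -> c *m a = a *m c) ->
  T *m tens (fun=> c) = tens (fun=> c) *m T.
Proof.
move=> Tg cA.
pose cX := char_poly_mx (- c); pose TX := map_mx polyC T.
have evc x : map_mx (horner_eval x) cX = c + x%:M.
  apply/matrixP=> i j; rewrite !mxE /horner_eval /= !hornerE addrC opprK.
  by case: (i == j); rewrite /= ?hornerE.
have evT x : map_mx (horner_eval x) TX = T.
  by apply/matrixP=> i j; rewrite !mxE /horner_eval hornerC.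
pose D := TX *m tens (fun=> cX) - tens (fun=> cX) *m TX.
have evD x : map_mx (horner_eval x) D =
    T *m tens (fun=> c + x%:M) - tens (fun=> c + x%:M) *m T.
  rewrite /D raddfB /= !map_mxM /= map_tens evT.
  by rewrite (eq_tens (Y := fun=> c + x%:M)) // => t; apply: evc.
suff D0 : D = 0.
  apply/eqP; rewrite -subr_eq0; apply/eqP; have := evD 0.
  by rewrite D0 map_mx0 raddf0 addr0 => <-.
apply/matrixP=> i j; rewrite [RHS]mxE; apply/eqP.
(* [char_poly (- c)] is the determinant of [c + x]; this factor makes the product vanish also at
   those [x] where [c + x] is singular. *)
suff : D i j * char_poly (- c) == 0.
  by rewrite mulf_eq0 (negPf (monic_neq0 (char_poly_monic _))) orbF.
apply/eqP/(poly_eq0_fun pcharF0) => x; rewrite hornerM.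
have [|nz] := eqVneq (char_poly (- c)).[x] 0; first by move->; rewrite mulr0.
have := evD x => /matrixP/(_ i j); rewrite mxE /horner_eval => ->.
rewrite Tg ?subrr ?mxE ?mul0r // => [|a Aa].
  rewrite unitmxE -evc det_map_mx unitfE //.
by rewrite mulmxDl mulmxDr cA // scalar_mxC.
Qed.

(** Polarization writes a symmetrized tensor as a combination of tensor powers of the partial sums
    of [c], which again centralize [A]. *)
Lemma commute_tens_polarize (T : 'M[F]_#|{: {ffun 'I_m -> 'I_n}}|) (c : 'I_m -> 'M[F]_n) :
  (forall c, (forall a, A a -> c *m a = a *m c) ->
     T *m tens (fun=> c) = tens (fun=> c) *m T) ->
  (forall t a, A a -> c t *m a = a *m c t) ->
  T *m (\sum_(s : 'S_m) tens (fun t => c (s t))) =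
  (\sum_(s : 'S_m) tens (fun t => c (s t))) *m T.
Proof.
move=> Tc cA.
have -> : \sum_(s : 'S_m) tens (fun t => c (s t)) =
    \sum_(S : {set 'I_m}) psign F S *: tens (fun=> \sum_(i in S) c i).
  apply/matrixP=> i j; rewrite !summxE.
  under eq_bigr => s _ do rewrite mxE.
  rewrite (sum_perm_polarize (fun t u => c u (enum_val i t) (enum_val j t))).
  apply: eq_bigr => S _; rewrite !mxE; congr (_ * _); apply: eq_bigr => t _.
  by rewrite summxE.
rewrite mulmx_sumr mulmx_suml; apply: eq_bigr => S _.
rewrite -scalemxAr -scalemxAl Tc // => a Aa.
by rewrite mulmx_sumr mulmx_suml; apply: eq_bigr => t _; apply: cA.
Qed.

Definition slotperm_tens_gen (T : 'M[F]_#|{: {ffun 'I_m -> 'I_n}}|) : Prop :=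
  exists (s : 'S_m) (a : 'I_m -> 'M[F]_n),
    (forall t, A (a t)) /\ T = slotperm_mx F n s *m tens a.

(** Averaging by [p] and [q] turns a pure tensor into a symmetrized tensor of elements centralizing
    [A]. These commute with [T], so [double_centralizer] applies. *)
Lemma centralizer_tens (T : 'M[F]_#|{: {ffun 'I_m -> 'I_n}}|) :
  (forall g, g \in unitmx -> (forall a, A a -> g *m a = a *m g) ->
     T *m tens (fun=> g) = tens (fun=> g) *m T) ->
  lspan slotperm_tens_gen T.
Proof.
move=> Tg; pose G := slotperm_tens_gen.
have [r [b [b' [Ab Ab' bb' bC]]]] := separability_idempotent pcharF0 sA ssA.
have [A0 A1 AD AZ AM] := sA.
have [|||B BE] := @vspace_of_pred _ _ (lspan G).
- by move=> Q.
- by move=> x y Gx Gy Q Q0 QD QZ QG; exact: QD (Gx Q Q0 QD QZ QG) (Gy Q Q0 QD QZ QG).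
- by move=> c x Gx Q Q0 QD QZ QG; exact: QZ (Gx Q Q0 QD QZ QG).
have GB a : G a -> a \in B by move=> Ga; apply/BE => Q _ _ _ QG; exact: QG.
(* An index [j] is a permutation with a choice of some [b i] in each slot. *)
pose p (j : 'S_m * {ffun 'I_m -> 'I_r}) :=
  slotperm_mx F n j.1 *m tens (fun t => b (j.2 t)).
pose q (j : 'S_m * {ffun 'I_m -> 'I_r}) :=
  tens (fun t => b' (j.2 t)) *m slotperm_mx F n j.1^-1.
have pqZ Z : \sum_j p j *m tens Z *m q j =
    \sum_(s : 'S_m) tens (fun t => \sum_i b i *m Z (s t) *m b' i).
  rewrite -(pair_bigA _ (fun (s : 'S_m) (f : {ffun 'I_m -> 'I_r}) =>
    p (s, f) *m tens Z *m q (s, f))) /=.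
  rewrite (reindex_inj invg_inj); apply: eq_bigr => s _.
  transitivity (slotperm_mx F n s^-1 *m
     tens (fun t => \sum_i b i *m Z t *m b' i) *m slotperm_mx F n s).
    rewrite tens_sum mulmx_sumr mulmx_suml; apply: eq_bigr => f _.
    rewrite /p /q /= invgK -!mulmxA; congr (_ *m _); rewrite !mulmxA !tensM.
    by congr (_ *m _).
  rewrite slotperm_tens -mulmxA slotpermM mulgV slotperm1 mulmx1.
  by apply: eq_tens => t; rewrite invgK.
apply/BE/(@double_centralizer _ _ p q _ _ m`!%:R).
- by rewrite natr_eq0 // -lt0n fact_gt0.
- transitivity (\sum_j p j *m tens (fun=> 1%:M) *m q j).
    by apply: eq_bigr => j _; rewrite tens1 mulmx1.
  rewrite pqZ (eq_bigr (fun _ => 1%:M)) => [|s _].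
    by rewrite sumr_const card_Sn -raddfMn.
  rewrite -tens1; apply: eq_tens => t; rewrite -[RHS]bb'.
  by apply: eq_bigr => i _; rewrite /= mulmx1.
- move=> j; apply: GB; exists (j.1^-1)%g, (fun t => b' (j.2 ((j.1^-1)%g t))); split=> //.
  rewrite slotperm_tens; congr (_ *m _); apply: eq_tens => t.
  by rewrite invgK permK.
(* A tensor moves past a slot permutation with its factors permuted, so products of generators are
   generators. *)
- move=> j a /BE aB; apply/BE => Q Q0 QD QZ QG; apply: (aB (fun a => Q (p j *m a))).
  + by rewrite mulmx0.
  + by move=> x y Qx Qy; rewrite mulmxDr; apply: QD.
  + by move=> c x Qx; rewrite -scalemxAr; apply: QZ.
  move=> _ [s [d [Ad ->]]]; apply: QG.
  exists (s * j.1)%g, (fun t => b (j.2 (s t)) *m d t); split.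
    by move=> t; apply: AM.
  rewrite /p -mulmxA mulmxA -[in LHS]mulmxA [tens _ *m (_ *m _)]mulmxA.
  rewrite (_ : tens _ *m slotperm_mx F n s =
     slotperm_mx F n s *m tens (fun t => b (j.2 (s t)))); last first.
    by rewrite slotperm_tens; congr (_ *m _); apply: eq_tens => t; rewrite permKV.
  by rewrite -[_ *m _ *m tens d]mulmxA tensM mulmxA slotpermM.
move=> S; rewrite [S]matrix_sum_delta.
have comZ Z : T *m (\sum_j p j *m tens Z *m q j) = (\sum_j p j *m tens Z *m q j) *m T.
  rewrite pqZ.
  apply: (commute_tens_polarize (c := fun u => \sum_i b i *m Z u *m b' i))
    => [c cA|t a Aa].
    exact: commute_tens_centralizer.
  by rewrite bC.
have -> : \sum_j p j *m (\sum_i \sum_k S i k *: delta_mx i k) *m q j =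
    \sum_i \sum_k S i k *: (\sum_j p j *m delta_mx i k *m q j).
  under eq_bigr => j _ do rewrite mulmx_sumr mulmx_suml.
  rewrite exchange_big; apply: eq_bigr => i _.
  under eq_bigr => j _ do rewrite mulmx_sumr mulmx_suml.
  rewrite exchange_big; apply: eq_bigr => k _; rewrite scaler_sumr.
  by apply: eq_bigr => j _; rewrite -scalemxAr -scalemxAl.
rewrite mulmx_sumr mulmx_suml; apply: eq_bigr => i _.
rewrite mulmx_sumr mulmx_suml; apply: eq_bigr => k _.
rewrite -scalemxAr -scalemxAl; congr (_ *: _).
by rewrite -[i]enum_valK -[k]enum_valK -tens_delta comZ.
Qed.
End DoubleCentralizer.

(** * Traces of permuted tensor products *)

Section TraceSum.
Variables (R : comNzRingType) (n : nat).

Lemma mxtrace_mul_delta p q (X : 'M[R]_(p, q)) i j : \tr (X *m delta_mx i j) = X j i.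
Proof.
rewrite /mxtrace (bigD1 j) //= big1 ?addr0 => [|k kj].
  rewrite mxE (bigD1 i) //= mxE !eqxx mulr1 big1 ?addr0 // => l li.
  by rewrite mxE (negPf li) mulr0.
by rewrite mxE big1 // => l _; rewrite mxE (negPf kj) andbF mulr0.
Qed.

(** A product over the cycles of [s] of traces of words in the [Z t], written as an index sum so
    that slots can be summed out singly. *)
Definition tracesum m (s : 'S_m) (Z : 'I_m -> 'M[R]_n) : R :=
  \sum_(I : {ffun 'I_m -> 'I_n}) \prod_t Z t (I (s t)) (I t).

Lemma mxtrace_slotperm_tens m (s : 'S_m) (Z : 'I_m -> 'M[R]_n) :
  \tr (slotperm_mx R n s *m tens Z) = tracesum s Z.
Proof.
rewrite /mxtrace /tracesum -sum_enum_val; apply: eq_bigr => i _.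
by rewrite mul_slotperm_mx mxE enum_rankK; apply: eq_bigr => t _; rewrite ffunE.
Qed.

Lemma sum_ffun_lift m (h : 'I_m.+1) (T : finType) (G : {ffun 'I_m.+1 -> T} -> R) :
  \sum_I G I =
  \sum_i \sum_(J : {ffun 'I_m -> T})
    G [ffun t => if unlift h t is Some u then J u else i].
Proof.
rewrite pair_bigA (reindex (fun p : T * {ffun 'I_m -> T} =>
  [ffun t => if unlift h t is Some u then p.2 u else p.1])) //.
exists (fun I : {ffun 'I_m.+1 -> T} => (I h, [ffun u : 'I_m => I (lift h u)])).
  move=> [i J] _; rewrite ffunE unlift_none; congr (_, _).
  by apply/ffunP=> u; rewrite !ffunE liftK.
move=> I _; apply/ffunP=> t; rewrite ffunE /=.
by case: unliftP => [u ->|->]; rewrite ?ffunE.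
Qed.

(** This removes slot [0] from its cycle by sending its predecessor to its successor. *)
Lemma perm_ord0_lift m (s : 'S_m.+1) :
  exists s' : 'S_m, forall u, lift ord0 (s' u) =
    if s (lift ord0 u) == ord0 then s ord0 else s (lift ord0 u).
Proof.
pose f u := if s (lift ord0 u) == ord0 then s ord0 else s (lift ord0 u).
have f0 u : f u != ord0.
  rewrite /f; case: ifP => [/eqP su|/negbT//].
  apply: contra (neq_lift ord0 u) => /eqP s0.
  by rewrite -(inj_eq (@perm_inj _ s)) su s0.
have fl u : exists v, f u = lift ord0 v.
  by have := f0 u; case: (unliftP ord0 (f u)) => [v ->|->]; [exists v|rewrite eqxx].
have finj : injective f.
  move=> u v; rewrite /f; case: ifP => [/eqP su|nu]; case: ifP => [/eqP sv|nv] e.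
  - by apply: (@lift_inj _ ord0); apply: (@perm_inj _ s); rewrite su sv.
  - by case/eqP: (neq_lift ord0 v); apply: perm_inj e.
  - by case/eqP: (neq_lift ord0 u); apply: perm_inj (esym e).
  - exact: (@lift_inj _ _ _ _ (perm_inj e)).
pose g u := odflt u (unlift ord0 (f u)).
have gE u : lift ord0 (g u) = f u by rewrite /g; have [v ->] := fl u; rewrite liftK.
have ginj : injective g by move=> u v e; apply: finj; rewrite -!gE e.
by exists (perm ginj) => u; rewrite permE gE.
Qed.

Lemma tracesum_fix m (s : 'S_m.+1) (s' : 'S_m) (Z : 'I_m.+1 -> 'M[R]_n) :
  s ord0 = ord0 -> (forall u, lift ord0 (s' u) = s (lift ord0 u)) ->
  tracesum s Z = \tr (Z ord0) * tracesum s' (fun u => Z (lift ord0 u)).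
Proof.
move=> s0 ss'; rewrite /tracesum (sum_ffun_lift ord0) mulr_suml; apply: eq_bigr => i _.
rewrite mulr_sumr; apply: eq_bigr => J _.
rewrite big_ord_recl s0 !ffunE unlift_none; congr (_ * _); apply: eq_bigr => u _.
by rewrite !ffunE -ss' !liftK.
Qed.

(** The index of slot [0] occurs only in [Z ord0] and in the factor of its predecessor; summing over
    it is their matrix product. *)
Lemma tracesum_merge m (s : 'S_m.+1) (s' : 'S_m) (Z : 'I_m.+1 -> 'M[R]_n) :
  s ord0 != ord0 ->
  (forall u, lift ord0 (s' u) =
     if s (lift ord0 u) == ord0 then s ord0 else s (lift ord0 u)) ->
  tracesum s Z =
  tracesum s' (fun u => if s (lift ord0 u) == ord0 then Z ord0 *m Z (lift ord0 u)
                        else Z (lift ord0 u)).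
Proof.
move=> s0 ss'.
have [u0 su0] : exists u0, s (lift ord0 u0) = ord0.
  have := permKV s ord0; case: (unliftP ord0 (s^-1%g ord0)) => [u ->|->].
    by exists u.
  by move/eqP; rewrite (negPf s0).
have su u : u != u0 -> (s (lift ord0 u) == ord0) = false.
  apply: contraNF => /eqP su; apply/eqP/(@lift_inj _ ord0)/(@perm_inj _ s).
  by rewrite su su0.
rewrite /tracesum (sum_ffun_lift ord0) exchange_big; apply: eq_bigr => J _.
rewrite (bigD1 u0) //= su0 eqxx mxE mulr_suml; apply: eq_bigr => i _.
rewrite big_ord_recl (bigD1 u0) //= su0 !ffunE unlift_none liftK.
have := ss' u0; rewrite su0 eqxx => <-; rewrite liftK mulrA; congr (_ * _).
apply: eq_bigr => u uu0; have := ss' u; rewrite !ffunE su // => <-.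
by rewrite !liftK.
Qed.

Variables (U D : 'M[R]_n -> Prop).
Hypotheses (UM : forall x y, U x -> U y -> U (x *m y)) (UD : forall x, U x -> D x).
Hypothesis DZ : forall u x, U u -> D x -> D (\tr u *: x).

(* The last slot carries the matrix units [delta_mx i j] that extract the
   entries of the result; the other slots are eliminated one at a time. *)
Lemma tracesum_closed m (s : 'S_m.+1) (Z : 'I_m.+1 -> 'M[R]_n) :
  (forall t, U (Z t)) ->
  D (\matrix_(j, i) tracesum s
       (fun t => if t == ord_max then Z t *m delta_mx i j else Z t)).
Proof.
elim: m s Z => [|m IH] s Z UZ.
  (* With one slot, the trace against [delta_mx i j] is the entry [(j, i)]; the empty [tracesum]
     that remains is [1]. *)
  rewrite (_ : \matrix_(_, _) _ = Z ord0); first exact: UD.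
  apply/matrixP=> j i; rewrite mxE (tracesum_fix (s' := 1%g)) ?ord1 //; last by case.
  rewrite [tracesum _ _](eq_bigr (fun=> 1)) => [|I _]; last by rewrite big_ord0.
  rewrite sumr_const card_ffun !card_ord expn0 mulr1.
  rewrite (_ : _ == _) ?mxtrace_mul_delta //.
have omax u : (lift ord0 u == ord_max :> 'I_m.+2) = (u == ord_max).
  have <- : lift ord0 (@ord_max m) = ord_max by apply: val_inj.
  by rewrite (inj_eq (@lift_inj _ _)).
have [s' ss'] := perm_ord0_lift s.
have [s0|s0] := eqVneq (s ord0) ord0.
  rewrite (_ : \matrix_(_, _) _ = \tr (Z ord0) *: \matrix_(j, i) tracesum s'
       (fun u => if u == ord_max then Z (lift ord0 u) *m delta_mx i j
                 else Z (lift ord0 u))).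
    by apply: DZ => //; apply: (IH s' (fun u => Z (lift ord0 u))).
  apply/matrixP=> j i; rewrite !mxE (tracesum_fix (s' := s')) //.
  move=> u; rewrite ss' ifN //; apply: contra (neq_lift ord0 u).
  by rewrite -[X in _ == X -> _]s0 (inj_eq perm_inj) eq_sym.
pose Z' u :=
  if s (lift ord0 u) == ord0 then Z ord0 *m Z (lift ord0 u) else Z (lift ord0 u).
(* Merging multiplies by [Z ord0] on the left, so the matrix unit stays at the right end of the last
   slot. *)
rewrite (_ : \matrix_(_, _) _ = \matrix_(j, i) tracesum s'
       (fun u => if u == ord_max then Z' u *m delta_mx i j else Z' u)).
  by apply: IH => u; rewrite /Z'; case: ifP => _; [apply: UM|].
apply/matrixP=> j i; rewrite !mxE (tracesum_merge (s' := s')) //.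
apply: eq_bigr => I _; apply: eq_bigr => u _; rewrite /Z' omax /=.
by case: (_ == ord0); case: (u == _); rewrite // mulmxA.
Qed.
End TraceSum.

(** * Iterated polynomial rings *)

Section MPolyMorphisms.
Variable R : comNzRingType.

Lemma mconst_is_zmod_morphism N : zmod_morphism (@mconst R N).
Proof. by elim: N => [|N IH] x y //=; rewrite IH raddfB. Qed.

Lemma mconst_is_monoid_morphism N : monoid_morphism (@mconst R N).
Proof.
elim: N => [|N [IH1 IHM]] //; split=> [|x y] /=; first by rewrite IH1.
by rewrite IHM polyCM.
Qed.

HB.instance Definition _ N :=
  GRing.isZmodMorphism.Build R (mpoly R N) (@mconst R N) (@mconst_is_zmod_morphism N).
HB.instance Definition _ N :=
  GRing.isMonoidMorphism.Build R (mpoly R N) (@mconst R N) (@mconst_is_monoid_morphism N).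

Variables (S : comNzRingType) (f : {rmorphism R -> S}) (v : nat -> S).

Lemma meval_is_rmorphism N :
  zmod_morphism (@meval R S f v N) * monoid_morphism (@meval R S f v N).
Proof.
elim: N => [|N [IHB IHM]] /=.
  split; first exact: raddfB.
  by split; [exact: rmorph1 | exact: rmorphM].
pose g : {rmorphism mpoly R N -> S} := HB.pack (@meval R S f v N)
  (GRing.isZmodMorphism.Build _ _ (@meval R S f v N) IHB)
  (GRing.isMonoidMorphism.Build _ _ (@meval R S f v N) IHM).
split; first by move=> p q; rewrite -[@meval _ _ _ _ _]/(g : _ -> _) rmorphB hornerD hornerN.
split=> [|p q]; rewrite -[@meval _ _ _ _ _]/(g : _ -> _).
  by rewrite rmorph1 hornerC.
by rewrite rmorphM hornerM.
Qed.

HB.instance Definition _ N :=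
  GRing.isZmodMorphism.Build (mpoly R N) S (@meval R S f v N) (meval_is_rmorphism N).1.
HB.instance Definition _ N :=
  GRing.isMonoidMorphism.Build (mpoly R N) S (@meval R S f v N) (meval_is_rmorphism N).2.

Lemma meval_const N c : meval f v (mconst N c) = f c.
Proof. by elim: N => //= N IH; rewrite map_polyC hornerC /= IH. Qed.

Lemma meval_var N m : (m < N)%N -> meval f v (mvar R N m) = v m.
Proof.
elim: N => //= N IH; rewrite ltnS leq_eqVlt; case: eqP => [-> _|_ /= /IH IHm].
  by rewrite map_polyX hornerX.
by rewrite map_polyC hornerC.
Qed.

Lemma mpoly_ind N (Q : mpoly R N -> Prop) :
  (forall c, Q (mconst N c)) -> (forall m, (m < N)%N -> Q (mvar R N m)) ->
  (forall p q, Q p -> Q q -> Q (p + q)) -> (forall p q, Q p -> Q q -> Q (p * q)) ->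
  forall p, Q p.
Proof.
elim: N Q => [|N IH] Q Qc Qv QD QM p; first exact: Qc.
have QC (a : mpoly R N) : Q a%:P.
  apply: (IH (fun a => Q a%:P)) => [c|m mN|x y Qx Qy|x y Qx Qy].
  - exact: Qc.
  - by have /= := Qv m (ltnW mN); rewrite (ltn_eqF mN).
  - by rewrite polyCD; apply: QD.
  - by rewrite polyCM; apply: QM.
have QX : Q 'X by have /= := Qv N (ltnSn N); rewrite eqxx.
by elim/poly_ind: p => [|p c Qp]; [exact: QC | apply/QD/QC/QM].
Qed.
End MPolyMorphisms.

Lemma mpoly_morphism_eq (R S : comNzRingType) N (f g : {rmorphism mpoly R N -> S}) :
  (forall c, f (mconst N c) = g (mconst N c)) ->
  (forall m, (m < N)%N -> f (mvar R N m) = g (mvar R N m)) -> f =1 g.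
Proof.
move=> fgc fgv; apply: mpoly_ind => // p q fgp fgq.
  by rewrite !rmorphD fgp fgq.
by rewrite !rmorphM fgp fgq.
Qed.

(** * Multilinear and homogeneous maps *)

Section MultilinearMap.
Variables (R : comNzRingType) (n d : nat).
Notation I := {ffun 'I_d -> 'I_n}.
Variable c : I -> I -> 'M[R]_n.

Definition mlmx (Z : 'I_d -> 'M[R]_n) : 'M[R]_n :=
  \sum_(i : I) \sum_(j : I) (\prod_t Z t (i t) (j t)) *: c i j.

(* The endomorphism whose trace against [Z_0 (x) ... (x) Z_d] is
   [tr (mlmx (Z_0, ..., Z_(d-1)) Z_d)]; slot [ord_max] carries the output. *)
Definition mltens : 'M[R]_#|{: {ffun 'I_d.+1 -> 'I_n}}| :=
  \matrix_(j < #|{: {ffun 'I_d.+1 -> 'I_n}}|, i < #|{: {ffun 'I_d.+1 -> 'I_n}}|)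
    c [ffun t => enum_val i (lift ord_max t)] [ffun t => enum_val j (lift ord_max t)]
      (enum_val j ord_max) (enum_val i ord_max).

Lemma mxtrace_mltens (Z : 'I_d.+1 -> 'M[R]_n) :
  \tr (mltens *m tens Z) = \tr (mlmx (fun t => Z (lift ord_max t)) *m Z ord_max).
Proof.
pose G (j i : {ffun 'I_d.+1 -> 'I_n}) :=
  c [ffun t => i (lift ord_max t)] [ffun t => j (lift ord_max t)]
    (j ord_max) (i ord_max) *
  \prod_t Z t (i t) (j t).
transitivity (\sum_j \sum_i G j i).
  rewrite /mxtrace -sum_enum_val; apply: eq_bigr => j _; rewrite mxE -sum_enum_val.
  by apply: eq_bigr => i _; rewrite !mxE.
rewrite (sum_ffun_lift ord_max); apply: eq_bigr => j0 _; rewrite mxE.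
under eq_bigr => J _ do rewrite (sum_ffun_lift ord_max).
rewrite exchange_big /=; apply: eq_bigr => i0 _.
rewrite exchange_big /mlmx summxE mulr_suml; apply: eq_bigr => i _.
rewrite summxE mulr_suml; apply: eq_bigr => j _.
rewrite /G mxE (bigD1_ord ord_max) //= !ffunE !unlift_none mulrCA [RHS]mulrC.
congr (_ * _).
rewrite mulrC; congr (_ * _).
  by apply: eq_bigr => t _; rewrite !ffunE !liftK.
by congr (c _ _ _ _); apply/ffunP=> t; rewrite !ffunE liftK.
Qed.

(** The hypothesis is equivariance under conjugation, freed of inverses by inserting [Z t *m g].
    Traces against matrix units, which are pure tensors, reduce the claim to it. *)
Lemma mltens_commute (g : 'M[R]_n) :
  (forall Z, mlmx (fun t => g *m Z t) *m g = g *m mlmx (fun t => Z t *m g)) ->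
  mltens *m tens (fun=> g) = tens (fun=> g) *m mltens.
Proof.
move=> cg; apply/matrixP=> j i; rewrite -!mxtrace_mul_delta.
rewrite -[i]enum_valK -[j]enum_valK -tens_delta.
rewrite -mulmxA tensM mxtrace_mltens mulmxA cg -!mulmxA.
rewrite [RHS]mxtrace_mulC -mulmxA tensM mxtrace_mltens.
by rewrite mxtrace_mulC -!mulmxA.
Qed.
End MultilinearMap.

Lemma map_mltens (R S : comNzRingType) (f : {rmorphism R -> S}) n d
    (c : {ffun 'I_d -> 'I_n} -> {ffun 'I_d -> 'I_n} -> 'M[R]_n) :
  map_mx f (mltens c) = mltens (fun i j => map_mx f (c i j)).
Proof. by apply/matrixP=> j i; rewrite !mxE. Qed.

Section HomogeneousMap.
Variables (F : fieldType) (n k d : nat).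
Notation V := ('I_k * ('I_n * 'I_n))%type.
Notation W := {ffun 'I_d -> V}.
Variable C : W -> 'M[F]_n.

Definition mxcoord (R : nzRingType) (xi : nat -> 'M[R]_n) (w : V) : R :=
  xi w.1 w.2.1 w.2.2.

(** Monomials are ordered words here, so different [C] can give the same map. *)
Definition homap (xi : nat -> 'M[F]_n) : 'M[F]_n :=
  \sum_(w : W) (\prod_t mxcoord xi (w t)) *: C w.

(* Coefficients of the full polarization of [homap], which equals [d!] times
   [homap] on the diagonal. *)
Definition symcoef (w : W) : 'M[F]_n := \sum_(s : 'S_d) C [ffun t => w (s t)].

(** Each word is polarized by [sum_perm_polarize]; reindexing the words then moves the permutation
    from [eta] to the coefficients. *)
Lemma polarize_homap (eta : 'I_d -> nat -> 'M[F]_n) :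
  \sum_(S : {set 'I_d}) psign F S *: homap (fun a => \sum_(t in S) eta t a) =
  \sum_(w : W) (\prod_t mxcoord (eta t) (w t)) *: symcoef w.
Proof.
under [RHS]eq_bigr => w _ do rewrite scaler_sumr.
under [LHS]eq_bigr => S _ do rewrite scaler_sumr.
rewrite exchange_big [RHS]exchange_big /=.
transitivity (\sum_(w : W) (\sum_(s : 'S_d) \prod_t mxcoord (eta (s t)) (w t)) *: C w).
  apply: eq_bigr => w _; rewrite (sum_perm_polarize (fun t u => mxcoord (eta u) (w t))).
  rewrite scaler_suml; apply: eq_bigr => S _; rewrite -scalerA.
  by congr (_ *: (_ *: _)); apply: eq_bigr => t _; rewrite /mxcoord summxE.
under [LHS]eq_bigr => w _ do rewrite scaler_suml.
rewrite exchange_big; apply: eq_bigr => s _.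
rewrite (reindex (fun w : W => [ffun t => w (s t)])) /=; last first.
  exists (fun w : W => [ffun t => w (s^-1%g t)]) => w _; apply/ffunP=> t;
    by rewrite !ffunE ?permK ?permKV.
apply: eq_bigr => w _; congr (_ *: _).
by rewrite [RHS](reindex_inj (@perm_inj _ s)); apply: eq_bigr => t _; rewrite ffunE.
Qed.

(** Permuting the letters of a word does not change its product, so all [d!] permutations contribute
    equally. *)
Lemma symcoef_sum (R : comNzRingType) (f : {rmorphism F -> R}) (X : V -> R) :
  \sum_(w : W) (\prod_t X (w t)) *: map_mx f (symcoef w) =
  (\sum_(w : W) (\prod_t X (w t)) *: map_mx f (C w)) *+ d`!.
Proof.
rewrite -(card_Sn d) -sumr_const.
transitivity (\sum_(s : 'S_d) \sum_(w : W)
  (\prod_t X (w t)) *: map_mx f (C [ffun t => w (s t)])).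
  rewrite exchange_big; apply: eq_bigr => w _; rewrite -scaler_sumr; congr (_ *: _).
  by rewrite /symcoef (raddf_sum (map_mx f)).
apply: eq_big => [s|s _]; first by rewrite inE.
rewrite [RHS](reindex (fun w : W => [ffun t => w (s t)])) /=; last first.
  exists (fun w : W => [ffun t => w (s^-1%g t)]) => w _; apply/ffunP=> t;
    by rewrite !ffunE ?permK ?permKV.
apply: eq_bigr => w _; congr (_ *: _).
by rewrite [LHS](reindex_inj (@perm_inj _ s)); apply: eq_bigr => t _; rewrite ffunE.
Qed.

Definition symform (al : {ffun 'I_d -> 'I_k}) (i j : {ffun 'I_d -> 'I_n}) : 'M[F]_n :=
  symcoef [ffun t => (al t, (i t, j t))].

Lemma sum_ffun_pair (R : nmodType) (T A B : finType) (G : {ffun T -> A * B} -> R) :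
  \sum_w G w = \sum_(a : {ffun T -> A}) \sum_(b : {ffun T -> B}) G [ffun t => (a t, b t)].
Proof.
rewrite pair_bigA (reindex (fun p : {ffun T -> A} * {ffun T -> B} =>
  [ffun t => (p.1 t, p.2 t)])) //.
exists (fun w : {ffun T -> A * B} => ([ffun t => (w t).1], [ffun t => (w t).2])).
  by move=> [a b] _; congr (_, _); apply/ffunP=> t; rewrite !ffunE.
by move=> w _; apply/ffunP=> t; rewrite !ffunE /=; case: (w t).
Qed.

(** Slot [t] is fed a tuple supported at the index [al t], which kills every word whose matrix
    indices differ from [al]. *)
Lemma mlmx_symform al (Z : 'I_d -> 'M[F]_n) :
  mlmx (symform al) Z =
  \sum_(S : {set 'I_d}) psign F S *:
    homap (fun a => \sum_(t in S) if a == al t then Z t else 0).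
Proof.
rewrite polarize_homap sum_ffun_pair (bigD1 al) //= [X in _ + X]big1 ?addr0 => [|al' nal].
  rewrite sum_ffun_pair; apply: eq_bigr => i _; apply: eq_bigr => j _.
  congr (_ *: symcoef _); last by apply/ffunP=> t; rewrite !ffunE.
  by apply: eq_bigr => t _; rewrite /mxcoord !ffunE /= eqxx.
rewrite big1 // => w _.
have /existsP[t tal] : [exists t, al' t != al t].
  rewrite -negb_forall; apply: contra nal => /forallP e.
  by apply/eqP/ffunP=> t; apply/eqP.
rewrite (bigD1 t) //= /mxcoord !ffunE /= (inj_eq val_inj) (negPf tal).
by rewrite mxE mul0r scale0r.
Qed.

(** Conjugating [Z t *m g] by [g] gives [g *m Z t], so equivariance of [homap] becomes the identity
    required by [mltens_commute]. *)
Lemma mlmx_symform_equiv al (g : 'M[F]_n) :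
  g \in unitmx ->
  (forall xi, homap (fun a => g *m xi a *m invmx g) *m g = g *m homap xi) ->
  forall Z, mlmx (symform al) (fun t => g *m Z t) *m g =
            g *m mlmx (symform al) (fun t => Z t *m g).
Proof.
move=> gU hg Z; rewrite !mlmx_symform mulmx_suml mulmx_sumr; apply: eq_bigr => S _.
rewrite -scalemxAl -scalemxAr -hg; congr (_ *: (_ *m _)).
apply: eq_bigr => w _; congr (_ *: _); apply: eq_bigr => t _; rewrite /mxcoord.
rewrite mulmx_sumr mulmx_suml; congr (fun_of_matrix _ _ _); apply: eq_bigr => u _.
by case: ifP => _; rewrite ?mulmx0 ?mul0mx // mulmxA mulmxK.
Qed.
End HomogeneousMap.

(** * Polynomial matrices as polynomial maps *)

Section GenericMatrices.
Variables (F : fieldType) (n k : nat).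
Notation P := (PR F n k).
Notation V := ('I_k * ('I_n * 'I_n))%type.
Notation C := (@cmx F n k).
Notation X := (@Defs.genmx F n k).

Lemma xidxK al (i j : 'I_n) :
  [/\ (xidx n al i j %/ (n * n) = al)%N, (xidx n al i j %% (n * n) %/ n = i)%N
    & (xidx n al i j %% n = j)%N].
Proof.
have n0 : (0 < n)%N by apply: leq_ltn_trans (ltn_ord i).
have ij : (i * n + j < n * n)%N.
  by rewrite (leq_trans (n := i.+1 * n)) ?leq_mul2r ?ltn_ord ?orbT // mulSnr ltn_add2l.
rewrite /xidx -addnA; split.
- by rewrite divnMDl ?muln_gt0 ?n0 // divn_small ?addn0.
- by rewrite modnMDl modn_small // divnMDl // divn_small ?addn0.
- by rewrite mulnA addnA -mulnDl modnMDl modn_small.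
Qed.

Lemma xidx_lt (al : 'I_k) (i j : 'I_n) : (xidx n al i j < nvars n k)%N.
Proof.
have n0 : (0 < n * n)%N by rewrite muln_gt0 (leq_ltn_trans _ (ltn_ord i)).
have [e _ _] := xidxK al i j.
by rewrite /nvars -ltn_divLR // e.
Qed.

Lemma mxnatE (R : nzRingType) (A : 'M[R]_n) (i j : 'I_n) : mxnat A i j = A i j.
Proof. by rewrite /mxnat !valK. Qed.

Lemma map_mxnat (R S : nzRingType) (f : {rmorphism R -> S}) (A : 'M[R]_n) i j :
  f (mxnat A i j) = mxnat (map_mx f A) i j.
Proof.
rewrite /mxnat; case: insub => [i'|]; last exact: rmorph0.
by case: insub => [j'|]; [rewrite mxE | exact: rmorph0].
Qed.

Lemma mvar_coord m : (m < nvars n k)%N ->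
  exists w : V, mvar F (nvars n k) m = mxcoord X w.
Proof.
move=> mN; have nn0 : (0 < n * n)%N.
  by rewrite lt0n; apply: contraTneq mN => nn0; rewrite /nvars nn0 muln0.
have n0 : (0 < n)%N by move: nn0; rewrite muln_gt0 andbb.
have alk : (m %/ (n * n) < k)%N by rewrite ltn_divLR.
have i_n : (m %% (n * n) %/ n < n)%N by rewrite ltn_divLR // ltn_mod.
have j_n : (m %% n < n)%N by rewrite ltn_mod.
exists (Ordinal alk, (Ordinal i_n, Ordinal j_n)).
rewrite /mxcoord mxE; congr (mvar _ _ _); rewrite /xidx /= -addnA.
rewrite {1}(divn_eq m (n * n)); congr (_ + _)%N.
rewrite {1}(divn_eq (m %% (n * n)) n); congr (_ + _)%N.
by rewrite modn_dvdm // dvdn_mulr.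
Qed.

(** Specialization of the generic matrices to [xi]; the quotients and remainders undo [xidx]. *)
Definition mxeval (xi : nat -> 'M[F]_n) : P -> F :=
  @meval F F idfun
    (fun m => mxnat (xi (m %/ (n * n))%N) ((m %% (n * n)) %/ n)%N (m %% n)%N) (nvars n k).

HB.instance Definition _ xi :=
  GRing.RMorphism.copy (mxeval xi) (mxeval xi).

Lemma gsubst_is_rmorphism (g : 'M[F]_n) :
  zmod_morphism (@gsubst F n k g) * monoid_morphism (@gsubst F n k g).
Proof.
split=> [x y|]; first by rewrite /gsubst rmorphB.
by split=> [|x y]; rewrite /gsubst ?rmorph1 ?rmorphM.
Qed.

HB.instance Definition _ g :=
  GRing.isZmodMorphism.Build P P (@gsubst F n k g) (gsubst_is_rmorphism g).1.
HB.instance Definition _ g :=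
  GRing.isMonoidMorphism.Build P P (@gsubst F n k g) (gsubst_is_rmorphism g).2.

Lemma mxeval_const xi c : mxeval xi (mconst (nvars n k) c) = c.
Proof. exact: meval_const. Qed.

Lemma mxeval_coord xi (w : V) : mxeval xi (mxcoord X w) = mxcoord xi w.
Proof.
case: w => al [i j]; rewrite /mxcoord mxE /mxeval meval_var ?xidx_lt //.
by have [-> -> ->] := xidxK al i j; rewrite mxnatE.
Qed.

Lemma mxeval_genmx xi al : (al < k)%N -> map_mx (mxeval xi) (X al) = xi al.
Proof.
move=> alk; apply/matrixP=> i j; rewrite mxE.
exact: (mxeval_coord xi (Ordinal alk, (i, j))).
Qed.

Lemma mxeval_cmx xi a : map_mx (mxeval xi) (C a) = a.
Proof. by apply/matrixP=> i j; rewrite !mxE mxeval_const. Qed.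

Lemma mxeval_gsubst xi g p :
  mxeval xi (gsubst g p) = mxeval (fun al => g *m xi al *m invmx g) p.
Proof.
apply: (mpoly_morphism_eq (f := mxeval xi \o gsubst g)
  (g := mxeval (fun al => g *m xi al *m invmx g))) => [c|m mN].
  by rewrite /= mxeval_const /gsubst meval_const mxeval_const.
rewrite /= /gsubst /mxeval !meval_var // -/(mxeval xi).
rewrite (map_mxnat (mxeval xi)) !map_mxM !mxeval_cmx mxeval_genmx //.
have nn0 : (0 < n * n)%N.
  by rewrite lt0n; apply: contraTneq mN => nn0; rewrite /nvars nn0 muln0.
by rewrite ltn_divLR.
Qed.

Lemma mxeval_gact xi g (M : 'M[P]_n) :
  map_mx (mxeval xi) (gact g M) =
  invmx g *m map_mx (mxeval (fun al => g *m xi al *m invmx g)) M *m g.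
Proof.
rewrite /gact !map_mxM !mxeval_cmx -map_mx_comp; congr (_ *m _ *m _).
by apply: eq_map_mx => p; apply: mxeval_gsubst.
Qed.

Definition wordmon (u : seq V) : P := \prod_(w <- u) mxcoord X w.

Lemma poly_words (p : P) :
  exists s : seq (F * seq V), p = \sum_(x <- s) mconst (nvars n k) x.1 * wordmon x.2.
Proof.
elim/mpoly_ind: p => [c|m mN|p q [s ->] [s' ->]|p q [s ->] [s' ->]].
- by exists [:: (c, [::])]; rewrite big_seq1 /wordmon big_nil mulr1.
- have [w ->] := mvar_coord mN; exists [:: (1, [:: w])].
  by rewrite big_seq1 /wordmon big_seq1 rmorph1 mul1r.
- by exists (s ++ s'); rewrite big_cat.
exists [seq (x.1 * y.1, x.2 ++ y.2) | x <- s, y <- s'].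
rewrite big_allpairs_dep mulr_suml; apply: eq_bigr => x _.
rewrite mulr_sumr; apply: eq_bigr => y _ /=.
by rewrite /wordmon big_cat rmorphM mulrACA.
Qed.

Lemma mx_words (M : 'M[P]_n) :
  exists s : seq ('M[F]_n * seq V), M = \sum_(x <- s) wordmon x.2 *: C x.1.
Proof.
pose Q (M : 'M[P]_n) := exists s : seq ('M[F]_n * seq V),
  M = \sum_(x <- s) wordmon x.2 *: C x.1.
rewrite -/(Q M) [M]matrix_sum_delta.
have Q0 : Q 0 by exists [::]; rewrite big_nil.
have QD x y : Q x -> Q y -> Q (x + y).
  by move=> [s ->] [s' ->]; exists (s ++ s'); rewrite big_cat.
apply: big_ind => // i _; apply: big_ind => // j _.
have [s ->] := poly_words (M i j).
exists [seq (x.1 *: delta_mx i j, x.2) | x <- s].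
rewrite big_map scaler_suml; apply: eq_bigr => x _ /=.
rewrite mulrC -scalerA; congr (_ *: _); apply/matrixP=> a b; rewrite !mxE.
by rewrite rmorphM rmorph_nat.
Qed.

Definition wordseq d (w : {ffun 'I_d -> V}) : seq V := [seq w t | t <- enum 'I_d].

(** The word [u] is hit exactly once, at [d = size u]. *)
Lemma sum_wordseq (R : nmodType) D (G : seq V -> R) (u : seq V) :
  (size u < D)%N ->
  \sum_(d < D) \sum_(w : {ffun 'I_d -> V} | wordseq w == u) G (wordseq w) = G u.
Proof.
move=> uD; rewrite (bigD1 (Ordinal uD)) //= [X in _ + X]big1 ?addr0 => [|d du]; last first.
  apply: big_pred0 => w; apply: contraNF du => /eqP wu.
  by rewrite -val_eqE /= -wu size_map size_enum_ord.
pose w0 : {ffun 'I_(size u) -> V} := [ffun t => tnth (in_tuple u) t].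
have w0E : wordseq w0 = u.
  rewrite -[RHS](map_tnth_enum (in_tuple u)).
  by apply: eq_map => t; rewrite ffunE.
rewrite (big_pred1 w0) ?w0E // => w; apply/eqP/eqP => [wu|->//].
apply/ffunP=> t; have /eq_in_map e : wordseq w = wordseq w0 by rewrite w0E.
by apply: e; rewrite mem_enum.
Qed.

Lemma mx_homogeneous (M : 'M[P]_n) :
  exists D (c : forall d, {ffun 'I_d -> V} -> 'M[F]_n),
    M = \sum_(d < D) \sum_(w : {ffun 'I_d -> V}) (\prod_t mxcoord X (w t)) *: C (c d w).
Proof.
have [s ->] := mx_words M.
pose c d (w : {ffun 'I_d -> V}) := \sum_(x <- s | wordseq w == x.2) x.1.
(* The successor is needed because degrees run strictly below [D]. *)
exists (\max_(x <- s) size x.2).+1, c.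
have monE d (w : {ffun 'I_d -> V}) :
    \prod_t mxcoord X (w t) = wordmon (wordseq w).
  by rewrite /wordmon big_map big_enum.
have inner d : \sum_(w : {ffun 'I_d -> V}) (\prod_t mxcoord X (w t)) *: C (c d w) =
    \sum_(x <- s) \sum_(w : {ffun 'I_d -> V} | wordseq w == x.2) wordmon (wordseq w) *: C x.1.
  rewrite [RHS](exchange_big_dep predT) //=; apply: eq_bigr => w _.
  by rewrite monE /c /cmx (raddf_sum (map_mx _)) scaler_sumr.
rewrite (eq_bigr _ (fun d _ => inner (nat_of_ord d))) exchange_big /=.
rewrite big_seq [RHS]big_seq.
apply: eq_bigr => x xs.
rewrite (sum_wordseq (fun u => wordmon u *: _)) // ltnS.
by rewrite (big_rem x) //= leq_maxl.
Qed.
End GenericMatrices.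

(** * Invariants *)

Section Invariants.
Variables (F : fieldType) (n k : nat).
Hypothesis pcharF0 : [pchar F] =i pred0.
Notation P := (PR F n k).
Notation V := ('I_k * ('I_n * 'I_n))%type.
Notation C := (@cmx F n k).
Notation X := (@Defs.genmx F n k).
Notation Kc := (mconst (nvars n k)).

Lemma homapZ d (c : {ffun 'I_d -> V} -> 'M[F]_n) (a : F) xi :
  homap c (fun al => a *: xi al) = a ^+ d *: homap c xi.
Proof.
rewrite /homap scaler_sumr; apply: eq_bigr => w _; rewrite scalerA; congr (_ *: _).
rewrite (eq_bigr (fun t => a * mxcoord xi (w t))) => [|t _].
  by rewrite big_split prodr_const card_ord.
by rewrite /mxcoord mxE.
Qed.

(** Scaling [xi] by [a] multiplies the degree [e] discrepancy [E e] by [a ^+ e]; the total is a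
    polynomial in [a] with only zero values, so every coefficient vanishes. *)
Lemma homap_equiv D (c : forall d, {ffun 'I_d -> V} -> 'M[F]_n) (g : 'M[F]_n) :
  let M : 'M[P]_n := \sum_(d < D) \sum_(w : {ffun 'I_d -> V})
             (\prod_t mxcoord X (w t)) *: C (c d w) in
  g \in unitmx -> gact g M = M -> forall d xi, (d < D)%N ->
  homap (c d) (fun al => g *m xi al *m invmx g) *m g = g *m homap (c d) xi.
Proof.
move=> M gU gM d xi dD.
have evM xi' : map_mx (mxeval xi') M = \sum_(d < D) homap (c d) xi'.
  rewrite (raddf_sum (map_mx _)); apply: eq_bigr => e _.
  rewrite (raddf_sum (map_mx _)); apply: eq_bigr => w _.
  apply/matrixP=> i j; rewrite !mxE /= rmorphM rmorph_prod /= mxeval_const.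
  by congr (_ * _); apply: eq_bigr => t _; apply: mxeval_coord.
pose conj (xi : nat -> 'M[F]_n) al := g *m xi al *m invmx g.
pose E e := invmx g *m homap (c e) (conj xi) *m g - homap (c e) xi.
suff E0 : E d = 0.
  have /eqP := E0; rewrite subr_eq0 => /eqP <-.
  by rewrite !mulmxA mulmxV // mul1mx.
apply/matrixP=> i j; rewrite [RHS]mxE.
pose q := \poly_(e < D) E e i j.
suff q0 : q = 0 by have := congr1 (fun q : {poly F} => q`_d) q0; rewrite coef_poly dD coef0.
apply: (poly_eq0_fun pcharF0) => a; rewrite horner_poly.
have := mxeval_gact (fun al => a *: xi al) g M; rewrite gM !evM.
move=> /eqP; rewrite eq_sym -subr_eq0 => /eqP/matrixP/(_ i j); rewrite [RHS]mxE => e0.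
rewrite -[RHS]e0.
rewrite mulmx_sumr mulmx_suml -sumrB summxE; apply: eq_bigr => e _.
have -> : homap (c e) (fun al => g *m (a *: xi al) *m invmx g) =
    a ^+ e *: homap (c e) (conj xi).
  rewrite -homapZ; apply: eq_bigr => w _; congr (_ *: _); apply: eq_bigr => t _.
  by rewrite /mxcoord /conj -scalemxAr -scalemxAl.
by rewrite homapZ -scalemxAr -scalemxAl -scalerBr [RHS]mxE mulrC.
Qed.

Variable A : 'M[F]_n -> Prop.
Hypotheses (sA : unital_subalg A) (ssA : semisimple_alg A).

Lemma alg_gen_sub (S S' : 'M[P]_n -> Prop) M :
  (forall M, S M -> S' M) -> alg_gen S M -> alg_gen S' M.
Proof.
move=> SS'; elim=> [N /SS'|||c N _|]; [exact: ag_base|exact: ag_one|..].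
- by move=> N N' _ ? _; apply: ag_add.
- exact: ag_scale.
- by move=> N N' _ ? _; apply: ag_mul.
Qed.

Lemma Rbar0 : @Rbar F n k A 0.
Proof.
rewrite -(scale0r (1%:M : 'M[P]_n)) (_ : 0 = Kc 0); last by rewrite rmorph0.
exact/ag_scale/ag_one.
Qed.

Lemma Rbar_sum (I : Type) (r : seq I) (Q : pred I) (f : I -> 'M[P]_n) :
  (forall i, Q i -> Rbar A (f i)) -> Rbar A (\sum_(i <- r | Q i) f i).
Proof.
by move=> Rf; elim/big_ind: _ => // [|x y]; [exact: Rbar0 | exact: ag_add].
Qed.

(** The contraction is linear in [T], so [centralizer_tens] reduces it to a slot permutation times a
    tensor of elements of [A], where [tracesum_closed] applies. *)
Lemma Rbar_mltens d (T : 'M[F]_#|{: {ffun 'I_d.+1 -> 'I_n}}|) (al : {ffun 'I_d -> 'I_k}) :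
  (forall g, g \in unitmx -> (forall a, A a -> g *m a = a *m g) ->
     T *m tens (fun=> g) = tens (fun=> g) *m T) ->
  Rbar A (\matrix_(j, i) \tr (map_mx Kc T *m tens (fun t =>
    if unlift ord_max t is Some u then X (al u) else delta_mx i j))).
Proof.
move=> /(centralizer_tens pcharF0 sA ssA) /(_ (fun T => Rbar A (\matrix_(j, i)
  \tr (map_mx Kc T *m tens (fun t =>
    if unlift ord_max t is Some u then X (al u) else delta_mx i j))))); apply.
- rewrite (_ : \matrix_(_, _) _ = 0); first exact: Rbar0.
  by apply/matrixP=> j i; rewrite !mxE map_mx0 mul0mx mxtrace0.
- move=> x y Rx Ry; have := ag_add Rx Ry; congr (alg_gen _ _).
  by apply/matrixP=> j i; rewrite !mxE map_mxD mulmxDl mxtraceD.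
- move=> c x Rx; have := ag_scale c Rx; congr (alg_gen _ _).
  by apply/matrixP=> j i; rewrite !mxE map_mxZ -scalemxAl mxtraceZ.
move=> _ [s [a [Aa ->]]].
(* The output slot gets [1%:M], since [tracesum_closed] inserts the matrix unit there. *)
pose Z t := C (a t) *m (if unlift ord_max t is Some u then X (al u) else 1%:M).
have UZ t : alg_gen (AX A) (Z t).
  apply: ag_mul; first by apply: ag_base; left; exists (a t).
  by case: (unlift _ _) => [u|]; [apply: ag_base; right; exists (al u) | exact: ag_one].
have := @tracesum_closed P n (@alg_gen F n k (AX A)) (@Rbar F n k A) _ _ _ d s Z UZ.
rewrite (_ : (\matrix_(j, i) tracesum s _) = \matrix_(j, i) \tr (map_mx Kc
   (slotperm_mx F n s *m tens a) *m tens (fun t =>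
    if unlift ord_max t is Some u then X (al u) else delta_mx i j))).
  apply.
  - exact: ag_mul.
  - by move=> x; apply: alg_gen_sub => N; left.
  - move=> u x Uu Rx; rewrite -mul_scalar_mx; apply: ag_mul => //.
    by apply: ag_base; right; exists u.
apply/matrixP=> j i; rewrite !mxE map_mxM -mulmxA.
rewrite (_ : map_mx Kc (slotperm_mx F n s) = slotperm_mx P n s); last first.
  by apply/matrixP=> b b'; rewrite !mxE rmorph_nat.
rewrite map_tens tensM mxtrace_slotperm_tens.
apply: eq_bigr => b _; apply: eq_bigr => t _; congr (fun_of_matrix _ _ _).
rewrite /Z; case: unliftP => [u ->|->]; last by rewrite eqxx mulmx1.
by rewrite eq_sym (negPf (neq_lift _ _)).
Qed.

(** Up to the factor [d!], each homogeneous part is a sum over [al] of its polarizations at generic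
    matrices; these are contractions of tensors commuting with the powers of [g]. *)
Lemma invariant_Rbar (M : 'M[P]_n) :
  (forall g : 'M[F]_n, g \in unitmx -> (forall a, A a -> g *m a = a *m g) ->
     gact g M = M) ->
  Rbar A M.
Proof.
have [D [c ->]] := mx_homogeneous M => gM.
apply: Rbar_sum => d _; set Md := \sum_w _.
have d0 : d`!%:R != 0 :> F by rewrite natr_eq0 // -lt0n fact_gt0.
have -> : Md = Kc (d`!%:R^-1) *: (Md *+ d`!).
  rewrite -scaler_nat scalerA -(rmorph_nat (@mconst F (nvars n k))) -rmorphM.
  by rewrite mulVf // rmorph1 scale1r.
apply: ag_scale; rewrite -symcoef_sum sum_ffun_pair; apply: Rbar_sum => al _.
rewrite sum_ffun_pair.
have cT g : g \in unitmx -> (forall a, A a -> g *m a = a *m g) ->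
    mltens (symform (c d) al) *m tens (fun=> g) =
    tens (fun=> g) *m mltens (symform (c d) al).
  move=> gU gA; apply: mltens_commute; apply: mlmx_symform_equiv => // xi.
  exact: (homap_equiv gU (gM g gU gA)).
have := Rbar_mltens al cT; congr (Rbar _ _).
apply/matrixP=> j0 i0; rewrite mxE map_mltens mxtrace_mltens unlift_none mxtrace_mul_delta.
congr (fun_of_matrix _ _ _); apply: eq_bigr => i _; apply: eq_bigr => j _.
congr (_ *: _); first by apply: eq_bigr => t _; rewrite !ffunE liftK.
rewrite /symform; congr (map_mx _ (symcoef _ _)); apply/ffunP=> t.
by rewrite !ffunE.
Qed.

(** [gact g] respects sums, products and scalars and fixes the generators: on [X al] the final
    conjugation undoes the substitution, and elements of [A] commute with [g]. *)
Lemma Rbar_invariant (M : 'M[P]_n) (g : 'M[F]_n) :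
  g \in unitmx -> (forall a, A a -> g *m a = a *m g) -> Rbar A M -> gact g M = M.
Proof.
move=> gU gA.
have CV : C g *m C (invmx g) = 1%:M by rewrite -map_mxM mulmxV // map_mx1.
have VC : C (invmx g) *m C g = 1%:M by rewrite -map_mxM mulVmx // map_mx1.
have gactD (N N' : 'M[P]_n) : gact g (N + N') = gact g N + gact g N'.
  by rewrite /gact raddfD mulmxDr mulmxDl.
have gactM (N N' : 'M[P]_n) : gact g (N *m N') = gact g N *m gact g N'.
  by rewrite /gact map_mxM !mulmxA -[_ *m C g *m C _]mulmxA CV mulmx1.
have gsub_const a : gsubst g (Kc a) = Kc a by rewrite /gsubst meval_const.
have gactZ a (N : 'M[P]_n) : gact g (Kc a *: N) = Kc a *: gact g N.
  by rewrite /gact map_mxZ /= gsub_const -scalemxAr -scalemxAl.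
have gact1 : gact g (1%:M : 'M[P]_n) = 1%:M.
  by rewrite /gact map_mx1 mulmx1.
have gactAX (N : 'M[P]_n) : AX A N -> gact g N = N.
  case=> [[a [Aa ->]]|[al [alk ->]]].
    rewrite /gact (_ : map_mx _ (C a) = C a).
      by rewrite -!map_mxM -mulmxA -gA // mulmxA mulVmx // mul1mx.
    by apply/matrixP=> i j; rewrite !mxE gsub_const.
  rewrite /gact (_ : map_mx _ (X al) = C g *m X al *m C (invmx g)).
    by rewrite !mulmxA VC mul1mx -mulmxA VC mulmx1.
  apply/matrixP=> i j; rewrite [in LHS]mxE [X al i j]mxE /gsubst.
  have [e1 e2 e3] := xidxK al i j.
  by rewrite meval_var ?(xidx_lt (Ordinal alk)) // e1 e2 e3 mxnatE.
have gactU (u : 'M[P]_n) : alg_gen (AX A) u -> gact g u = u.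
  elim=> [N /gactAX||N N' _ Hu _ Hv|a N _ Hu|N N' _ Hu _ Hv] //.
  - by rewrite gactD Hu Hv.
  - by rewrite gactZ Hu.
  - by rewrite gactM Hu Hv.
elim=> [N||N N' _ Hu _ Hv|a N _ Hu|N N' _ Hu _ Hv] //.
- case=> [/gactAX//|[u [Uu ->]]].
  (* Conjugation preserves traces and [u] is already fixed, so the substitution fixes [\tr u]. *)
  rewrite /gact map_scalar_mx scalar_mxC -mulmxA VC mulmx1; congr (_%:M).
  by rewrite -[in RHS](gactU u Uu) /gact mxtrace_mulC mulmxA CV mul1mx trace_map_mx.
- by rewrite gactD Hu Hv.
- by rewrite gactZ Hu.
- by rewrite gactM Hu Hv.
Qed.
End Invariants.

Theorem theorem5p11 (F : fieldType) (n k : nat) (A : 'M[F]_n -> Prop) :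
  [pchar F] =i pred0 ->
  unital_subalg A ->
  semisimple_alg A ->
  forall M : 'M[PR F n k]_n,
    (forall g : 'M[F]_n, g \in unitmx -> (forall a, A a -> g *m a = a *m g) ->
       gact g M = M)
    <-> Rbar A M.
Proof.
move=> pcharF0 sA ssA M; split; first exact: invariant_Rbar.
by move=> RM g gU gA; apply: Rbar_invariant RM.
Qed.
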